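(* Let $\rho_2^*=\tfrac12(\sqrt2+\sqrt6)$. Let $\rho\ge\rho_2^*$ and $n\ge2$, and assume either $\lambda>1$, or $0<\lambda<1$ and $n$ is odd. Then $$\min_{z\in\mathcal{E}_\rho}|C_n^\lambda(z)|=\big|C_n^\lambda\big(\pm\tfrac{i}{2}(\rho-\rho^{-1})\big)\big|,$$ i.e. the minimum of $|C_n^\lambda|$ over $\mathcal{E}_\rho$ is attained at the two endpoints of the minor axis.
   Context: $C_n^\lambda$ ($\lambda>-\tfrac12$) is the Gegenbauer polynomial, orthogonal on $[-1,1]$ with respect to $(1-x^2)^{\lambda-1/2}$, normalized by $C_n^\lambda(x)=\frac{\Gamma(\lambda+\frac12)\Gamma(n+2\lambda)}{\Gamma(2\lambda)\Gamma(n+\lambda+\frac12)}P_n^{(\lambda-\frac12,\lambda-\frac12)}(x)$ with $P_n^{(\alpha,\beta)}$ the Jacobi polynomial. The number $\rho_2^*$ is the unique root in $(1,\infty)$ of $\tfrac12(\rho^3+\rho^{-3})-\tfrac32(\rho+\rho^{-1})=0$. The Bernstein ellipse is $\mathcal{E}_\rho=\{\tfrac12(u+u^{-1}): u=\rho e^{i\theta},\ 0\le\theta<2\pi\}$. *)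

(* Defs.v *)
From Stdlib Require Import Reals Lra.
Open Scope R_scope.

Definition Cx : Type := (R * R)%type.
Definition Cre (z : Cx) : R := fst z.
Definition Cim (z : Cx) : R := snd z.
Definition Cof (a : R) : Cx := (a, 0).
Definition Cadd (z w : Cx) : Cx := (Cre z + Cre w, Cim z + Cim w).
Definition Copp (z : Cx) : Cx := (- Cre z, - Cim z).
Definition Csub (z w : Cx) : Cx := Cadd z (Copp w).
Definition Cmul (z w : Cx) : Cx :=
  (Cre z * Cre w - Cim z * Cim w, Cre z * Cim w + Cim z * Cre w).
Definition Cscal (a : R) (z : Cx) : Cx := (a * Cre z, a * Cim z).
Definition Cinv (z : Cx) : Cx :=
  let d := Cre z ^ 2 + Cim z ^ 2 in (Cre z / d, - Cim z / d).
Definition Cabs (z : Cx) : R := sqrt (Cre z ^ 2 + Cim z ^ 2).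
Definition Cpolar (rho theta : R) : Cx := (rho * cos theta, rho * sin theta).

(* Gegenbauer polynomials C_n^lambda evaluated at complex z, via the standard
   three-term recurrence (equivalent to the Jacobi normalization in the paper):
     C_0 = 1, C_1 = 2 lambda z,
     n C_n = 2 (n + lambda - 1) z C_{n-1} - (n + 2 lambda - 2) C_{n-2}.
   gegen_pair lam n z = (C_n(z), C_{n+1}(z)). *)
Fixpoint gegen_pair (lam : R) (n : nat) (z : Cx) : Cx * Cx :=
  match n with
  | O => (Cof 1, Cscal (2 * lam) z)
  | S m =>
      let p := gegen_pair lam m z in
      let a := fst p in
      let b := snd p in
      (b, Csub (Cscal (2 * (INR m + 1 + lam) / (INR m + 2)) (Cmul z b))
               (Cscal ((INR m + 2 * lam) / (INR m + 2)) a))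
  end.

Definition gegenbauer (lam : R) (n : nat) (z : Cx) : Cx := fst (gegen_pair lam n z).

Definition bernstein_ellipse (rho : R) (z : Cx) : Prop :=
  exists theta : R, 0 <= theta < 2 * PI /\
    z = Cscal (1/2) (Cadd (Cpolar rho theta) (Cinv (Cpolar rho theta))).

Definition rho2_star : R := (sqrt 2 + sqrt 6) / 2.

(* Main.v *)
(** Up to a constant, C_n^lam(z) = z^e * prod_j (z^2 - y_j), where e is the parity
    of n and the y_j in (0, 1) are the squares of the positive zeros.  On the ellipse
    with rho^2 + rho^-2 >= 4, each quotient |z^2 - y| / |z0^2 - y|, z0 being an end of
    the minor axis, decreases in y, and the y_j decrease in lam.  So the minimum
    property for lam follows from the one for a smaller parameter: lam = 1
    (Chebyshev U_n) when lam > 1, and lam = 0 (Chebyshev T_n) when n is odd.  In both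
    reference cases the modulus is explicit in u, with z = (u + u^-1) / 2.

    The zeros are compared through Stieltjes' equilibrium equations
      (1 + 2 e) / y_j + 4 sum_(k <> j) 1 / (y_j - y_k) = (2 lam + 1) / (1 - y_j).
    If some zero increased with lam, then at an index j where the increase is largest
    the left side would strictly decrease, while the right side does not. *)

From mathcomp Require all_boot all_order all_algebra.
From mathcomp Require complex polyrcf ring lra Rstruct.
From Stdlib Require Rdefinitions Rfunctions.
Require Defs.

Module GegenbauerZeros.
Import all_boot all_order all_algebra complex polyrcf ring lra Rstruct.
Import Order.TTheory GRing.Theory Num.Theory.
Set Implicit Arguments. Unset Strict Implicit. Unset Printing Implicit Defensive.
Local Open Scope ring_scope.

(* The monic normalization stays meaningful at lam = 0, where it yields T_n.  There the
   general formula reads 0 / 0 at n = 0; the first branch is its limit. *)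
Definition rec_coef (F : fieldType) (lam : F) (n : nat) : F :=
  if n is 0 then (2 * (1 + lam))^-1
  else n.+1%:R * (n%:R + 2 * lam) / (4 * (n.+1%:R + lam) * (n%:R + lam)).

Fixpoint geg_pair (F : fieldType) (lam : F) (n : nat) : {poly F} * {poly F} :=
  if n is m.+1 then
    let p := geg_pair lam m in (p.2, 'X * p.2 - rec_coef lam m *: p.1)
  else (1, 'X).
Definition geg (F : fieldType) (lam : F) (n : nat) : {poly F} := (geg_pair lam n).1.

(** * Degree and parity of the monic polynomials *)

Section Recurrence.
Context (F : fieldType) (lam : F).

Lemma geg0 : geg lam 0 = 1. Proof. by []. Qed.
Lemma geg1 : geg lam 1 = 'X. Proof. by []. Qed.
Lemma gegSS n : geg lam n.+2 = 'X * geg lam n.+1 - rec_coef lam n *: geg lam n.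
Proof. by []. Qed.

Lemma size_monic_geg n : size (geg lam n) = n.+1 /\ geg lam n \is monic.
Proof.
suff: (size (geg lam n) = n.+1 /\ geg lam n \is monic) /\
      (size (geg lam n.+1) = n.+2 /\ geg lam n.+1 \is monic) by case.
elim: n => [|n [[s0 m0] [s1 m1]]].
  by rewrite geg0 geg1 size_poly1 size_polyX monic1 monicX.
split=> //; rewrite gegSS.
have sX : size ('X * geg lam n.+1) = n.+3.
  by rewrite mulrC size_mulX ?s1 // -size_poly_eq0 s1.
have lt : (size (- (rec_coef lam n *: geg lam n)) < size ('X * geg lam n.+1)%R)%N.
  by rewrite size_polyN sX (leq_ltn_trans (size_scale_leq _ _)) // s0.
rewrite size_polyDl // sX; split=> //.
by rewrite monicE lead_coefDl // -monicE monicMl // monicX.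
Qed.

Lemma geg_parity n x : (geg lam n).[- x] = (-1) ^+ n * (geg lam n).[x].
Proof.
suff: (geg lam n).[- x] = (-1) ^+ n * (geg lam n).[x] /\
      (geg lam n.+1).[- x] = (-1) ^+ n.+1 * (geg lam n.+1).[x] by case.
elim: n => [|n [h0 h1]].
  by rewrite geg0 geg1 expr0 expr1 !hornerE mulN1r.
split=> //; rewrite gegSS !hornerE h0 h1 !exprS; ring.
Qed.
End Recurrence.

(** * Structure relations and the differential equation *)

Section Nonneg.
Context (F : numFieldType) (lam : F) (lam0 : 0 <= lam).

Lemma natDlam_neq0 n : n.+1%:R + lam != 0.
Proof. by rewrite gt_eqF // ltr_pwDl ?ltr0Sn. Qed.

Lemma rec_coef_gt0 n : 0 < rec_coef lam n.
Proof.
case: n => [|n] /=; first by rewrite invr_gt0 mulr_gt0 // ltr_pwDl.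
have h k : 0 < k.+1%:R + lam by rewrite ltr_pwDl ?ltr0Sn.
by rewrite divr_gt0 ?mulr_gt0 ?ltr0Sn // ltr_pwDl ?ltr0Sn // mulr_ge0.
Qed.

(** Matches the coefficient of [geg lam n.+1] produced by differentiating the recurrence with the
    one [geg_structure] prescribes at the next index. *)
Lemma rec_coef_step n :
  1 + 2 * (n%:R + lam) * rec_coef lam n =
  2 * (n.+2%:R + lam) * rec_coef lam n.+1.
Proof.
have h1 := natDlam_neq0 n; have h2 := natDlam_neq0 n.+1.
case: n h1 h2 => [|n] h1 h2 /=.
  by field; rewrite h1.
have h3 := natDlam_neq0 n.
rewrite -(natr1 n.+2) -(natr1 n.+1) -(natr1 n) in h1 h2 h3 *.
by field; rewrite h1 h2 h3.
Qed.

(** Simultaneous induction: the first relation at [n.+1] is the second at [n] rewritten by the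
    recurrence; the second at [n.+1] comes from the differentiated recurrence and both relations at
    [n]. *)
Lemma geg_structure n :
  (1 - 'X^2) * (geg lam n)^`() =
    (n%:R + 2 * lam) *: ('X * geg lam n) - (2 * (n%:R + lam)) *: geg lam n.+1 /\
  (1 - 'X^2) * (geg lam n.+1)^`() =
    - (n.+1%:R *: ('X * geg lam n.+1)) + (2 * (n.+1%:R + lam) * rec_coef lam n) *: geg lam n.
Proof.
elim: n => [|n [h0 h1]].
  rewrite geg0 geg1 derivC derivX mulr1 mulr0 /=; split.
    by rewrite !add0r subrr.
  have h := natDlam_neq0 0.
  by rewrite divff ?mulf_neq0 ?pnatr_eq0 // mulr1 !scale1r addrC -expr2.
have bs := rec_coef_step n.
split.
  rewrite h1 gegSS -!mul_polyC -?(natr1 n.+1) -?(natr1 n) !(rmorphD, rmorphM, rmorphN, rmorph1, rmorph_nat) /=; ring.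
have -> : (1 - 'X^2) * (geg lam n.+2)^`() =
   (1 - 'X^2) * geg lam n.+1 + 'X * ((1 - 'X^2) * (geg lam n.+1)^`())
   - rec_coef lam n *: ((1 - 'X^2) * (geg lam n)^`()).
  rewrite gegSS derivB derivM derivX derivZ -!mul_polyC; ring.
rewrite -bs h0 h1 gegSS -!mul_polyC -?(natr1 n.+1) -?(natr1 n) !(rmorphD, rmorphM, rmorphN, rmorph1, rmorph_nat) /=; ring.
Qed.

(** The Gegenbauer equation at a root, where its undifferentiated term vanishes. It follows from the
    structure relations by eliminating [geg lam n.+1]. *)
Lemma geg_ode_root n x : root (geg lam n) x ->
  (1 - x ^+ 2) != 0 ->
  (1 - x ^+ 2) * (geg lam n)^`()^`().[x] = (2 * lam + 1) * x * (geg lam n)^`().[x].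
Proof.
move=> /rootP g0 xn0; have [h0 h1] := geg_structure n.
have h2 := congr1 (fun p => p^`().[x]) h0.
have {}h0 := congr1 (fun p => p.[x]) h0.
have {}h1 := congr1 (fun p => p.[x]) h1.
move: h0 h1 h2; rewrite !(derivE, hornerE) /= g0 => h0 h1 h2.
apply: (mulfI xn0).
move: h0 h1 h2.
set a := (geg lam n)^`().[x]; set b := (geg lam n)^`()^`().[x].
set c := (geg lam n.+1).[x]; set d := (geg lam n.+1)^`().[x].
rewrite -(natr1 n) => h0 h1 h2.
apply/eqP; rewrite -subr_eq0; apply/eqP.
(* The brackets are the differentiated first relation, the second relation and the first relation at
   [x]; the multipliers cancel [d] and then [c]. *)
transitivity ((1 - x ^+ 2) * ((- (x + x) * a + (1 - x ^+ 2) * b) -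
    ((n%:R + 2 * lam) * (0 + x * a) - 2 * (n%:R + lam) * d))
  - 2 * (n%:R + lam) * ((1 - x ^+ 2) * d -
     (- ((n%:R + 1) * x * c) + 2 * (n%:R + 1 + lam) * rec_coef lam n * 0))
  + (n%:R + 1) * x * ((1 - x ^+ 2) * a -
     ((n%:R + 2 * lam) * x * 0 - 2 * (n%:R + lam) * c))); first by ring.
by rewrite h0 h1 h2 !subrr !mulr0 subrr addr0.
Qed.

(** At 1 the left side of the first structure relation vanishes, so consecutive values have a
    positive ratio. Index 1 is treated apart: at [n = 0], [lam = 0] both coefficients vanish. *)
Lemma geg_at1 n : 0 < (geg lam n).[1].
Proof.
elim: n => [|[|n] IH]; first by rewrite geg0 hornerE.
  by rewrite geg1 hornerE ltr01.
have := congr1 (fun p => p.[1]) (geg_structure n.+1).1.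
rewrite !hornerE expr1n subrr mul0r /= mulr1.
move/esym/eqP; rewrite subr_eq0 => /eqP h.
have n0 : 0 < n.+1%:R + lam by rewrite ltr_pwDl ?ltr0Sn.
have p0 : 0 < n.+1%:R + 2 * lam by rewrite ltr_pwDl ?ltr0Sn // mulr_ge0.
by move: IH; rewrite -(pmulr_rgt0 _ p0) h pmulr_rgt0 // mulr_gt0.
Qed.
End Nonneg.

(** * Sign changes and location of the zeros *)

Lemma ltn_homo_upto (F : numDomainType) (f : nat -> F) n :
  (forall i, (i.+1 < n)%N -> f i < f i.+1) ->
  forall i j, (i < j < n)%N -> f i < f j.
Proof.
move=> h i; elim=> [|j IH] /andP[ij jn]; first by rewrite ltn0 in ij.
have fj := h j jn; move: ij; rewrite ltnS leq_eqVlt => /orP[/eqP->//|ij].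
by apply: lt_trans fj; apply: IH; rewrite ij (ltnW jn).
Qed.

(** Exactly [n - i] factors are negative. *)
Lemma sign_prod_sub (F : realDomainType) (s : nat -> F) (x : F) i n :
  (i <= n)%N ->
  (forall j, (j < i)%N -> s j < x) -> (forall j, (i <= j < n)%N -> x < s j) ->
  0 < (-1) ^+ (n - i) * \prod_(j < n) (x - s j).
Proof.
move=> le_in lo hi; elim: n le_in hi => [|n IH] le_in hi.
  by rewrite big_ord0 sub0n mulr1.
move: le_in; rewrite leq_eqVlt => /orP[/eqP e|lt_in].
  rewrite e subnn mul1r prodr_gt0 // => j _; rewrite subr_gt0 lo // e; exact: ltn_ord.
rewrite big_ord_recr /= subSn // exprS.
have -> : forall a b c : F, -1 * a * (b * c) = (a * b) * (- c) by move=> *; ring.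
rewrite mulr_gt0 ?IH //; last by rewrite opprB subr_gt0 hi // ltnSn andbT.
by move=> j /andP[ij jn]; rewrite hi // ij ltnW.
Qed.

Lemma poly_alternating_roots (F : rcfType) (p : {poly F}) (a : nat -> F) k :
  (forall i, (i < k)%N -> a i < a i.+1 /\ p.[a i] * p.[a i.+1] < 0) ->
  exists t : nat -> F,
    forall i, (i < k)%N -> [/\ a i < t i, t i < a i.+1 & root p (t i)].
Proof.
elim: k => [|k IH] h; first by exists (fun=> 0).
case: IH => [i ik|t ht]; first by apply: h; rewrite ltnW.
have [ak pk] := h k (ltnSn k).
have [x xi rx] := poly_ivtoo (ltW ak) pk.
move: xi; rewrite in_itv /= => /andP[x1 x2].
exists (fun i => if i == k then x else t i) => i.
rewrite ltnS leq_eqVlt; case: eqP => [-> _|_ /= ik]; first by split.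
exact: ht.
Qed.

Section Zeros.
Context (F : rcfType) (lam : F) (lam0 : 0 <= lam).

(** Interlacing. The last clause carries the induction: [geg lam n.+1] alternates in sign along the
    zeros of [geg lam n]. *)
Lemma geg_simple_roots n : exists s : nat -> F,
  [/\ forall i j, (i < j < n)%N -> s i < s j,
      forall i, (i < n)%N -> -1 < s i < 1,
      geg lam n = \prod_(i < n) ('X - (s i)%:P) &
      forall i, (i < n)%N -> 0 < (-1) ^+ (n - i) * (geg lam n.+1).[s i]].
Proof.
elim: n => [|n [s [s_lt s_in s_G s_sgn]]].
  exists (fun=> 0); split=> [i j|i||i] //; first by rewrite andbC.
  by rewrite big_ord0 geg0.
(* The mesh -1, zeros of [geg lam n], 1 has [n.+1] intervals; a sign change of [geg lam n.+1] in
   each exhausts its degree. *)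
pose a i := if i is j.+1 then (if (j < n)%N then s j else 1) else -1.
have a_lt i : (i < n.+1)%N -> a i < a i.+1.
  case: i => [_|i]; rewrite /a.
    by case: ifP => [/s_in/andP[]//|_]; lra.
  rewrite ltnS => ilt; rewrite ilt.
  by case: ifP => [lt2|_]; [rewrite s_lt // leqnn | case/andP: (s_in _ ilt)].
have a_sgn i : (i <= n.+1)%N -> 0 < (-1) ^+ (n.+1 - i) * (geg lam n.+1).[a i].
  case: i => [_|i]; rewrite /a.
    by rewrite subn0 geg_parity mulrA -expr2 sqrr_sign mul1r geg_at1.
  rewrite ltnS subSS leq_eqVlt => /orP[/eqP->|ilt].
    by rewrite ltnn subnn mul1r geg_at1.
  by rewrite ilt s_sgn.
have [|t ht] := @poly_alternating_roots F (geg lam n.+1) a n.+1.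
  move=> i ilt; split; first exact: a_lt.
  have := a_sgn i (ltnW ilt); have := a_sgn i.+1 ilt.
  rewrite subSS subSn // exprS => h1 h2.
  have := mulr_gt0 h1 h2.
  have -> : forall e u v : F, e * v * (-1 * e * u) = e ^+ 2 * (- (u * v)).
    by move=> *; ring.
  by rewrite sqrr_sign mul1r oppr_gt0.
have t_lt : forall i j, (i < j < n.+1)%N -> t i < t j.
  apply: ltn_homo_upto => i ilt.
  have [_ h1 _] := ht i (ltnW ilt); have [h2 _ _] := ht i.+1 ilt.
  exact: lt_trans h1 h2.
have a_le i j : (i <= j)%N -> (j <= n.+1)%N -> a i <= a j.
  rewrite leq_eqVlt => /orP[/eqP-> //|ij] jn; apply: ltW.
  by apply: (@ltn_homo_upto _ a n.+2) => [k|]; [exact: a_lt | rewrite ij].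
have t_G : geg lam n.+1 = \prod_(i < n.+1) ('X - (t i)%:P).
  have [sz mon] := size_monic_geg lam n.+1.
  rewrite {1}(@all_roots_prod_XsubC _ (geg lam n.+1) (mkseq t n.+1)).
  - by rewrite (monicP mon) scale1r big_map -(big_mkord xpredT (fun i => 'X - (t i)%:P)).
  - by rewrite size_mkseq.
  - apply/(all_nthP 0) => i; rewrite size_mkseq => ilt; rewrite nth_mkseq //.
    by case: (ht i ilt).
  rewrite uniq_rootsE; apply/(uniqP 0) => i j.
  rewrite !inE size_mkseq => ilt jlt; rewrite !nth_mkseq // => e.
  case: (ltngtP i j) => // h.
    by have := t_lt i j; rewrite h jlt e ltxx => /(_ isT).
  by have := t_lt j i; rewrite h ilt e ltxx => /(_ isT).
exists t; split=> // i ilt; have [h1 h2 r] := ht i ilt.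
  apply/andP; split.
    by apply: le_lt_trans h1; apply: (a_le 0%N i) => //; apply: ltnW.
  by apply: (lt_le_trans h2); have := a_le i.+1 n.+1 ilt (leqnn _); rewrite {2}/a ltnn.
(* Exactly [i] of the [s j] lie below [t i]. There the recurrence reduces [geg lam n.+2] to a
   negative multiple of [geg lam n]. *)
have sgn : 0 < (-1) ^+ (n - i) * (geg lam n).[t i].
  rewrite s_G horner_prod (eq_bigr (fun j : 'I_n => t i - s j)); last first.
    by move=> j _; rewrite !hornerE.
  apply: sign_prod_sub => [|j ji|j /andP[ij jn]]; first by rewrite -ltnS.
    apply: le_lt_trans h1; have := a_le j.+1 i ji (ltnW ilt).
    by rewrite {1}/a (leq_trans ji) // -ltnS.
  apply: (lt_le_trans h2); have := a_le i.+1 j.+1 ij (ltnW jn).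
  by rewrite {2}/a jn.
rewrite gegSS !hornerE (rootP r) mulr0 sub0r subSn // exprS.
have -> : forall e b g : F, -1 * e * - (b * g) = b * (e * g) by move=> *; ring.
by rewrite mulr_gt0 // rec_coef_gt0.
Qed.

(** By parity the zeros are symmetric: a pair [x], [- x] contributes [X^2 - x^2], and since zeros
    are simple, 0 is one exactly when [n] is odd. *)
Lemma geg_factor n : exists ys : seq F,
  [/\ sorted <%R ys, forall y, y \in ys -> 0 < y < 1, size ys = n./2 &
      geg lam n = 'X^(odd n) * \prod_(y <- ys) ('X^2 - y%:P)].
Proof.
have [s [s_lt s_in s_G _]] := geg_simple_roots n.
pose rs := mkseq s n.
have rs_uniq : uniq rs.
  apply/(uniqP 0) => i j; rewrite !inE size_mkseq => ilt jlt; rewrite !nth_mkseq // => e.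
  case: (ltngtP i j) => // h.
    by have := s_lt i j; rewrite h jlt e ltxx => /(_ isT).
  by have := s_lt j i; rewrite h ilt e ltxx => /(_ isT).
have rs_G : geg lam n = \prod_(x <- rs) ('X - x%:P).
  by rewrite s_G big_map -(big_mkord xpredT (fun i => 'X - (s i)%:P)) /index_iota subn0.
have rs_root x : (x \in rs) = root (geg lam n) x by rewrite rs_G root_prod_XsubC.
have rs_in x : x \in rs -> -1 < x < 1.
  by rewrite /rs /mkseq => /mapP[k]; rewrite mem_iota add0n /= => /s_in h ->.
have rs_opp x : (- x \in rs) = (x \in rs).
  by rewrite !rs_root !rootE geg_parity mulf_eq0 signr_eq0.
pose pos : seq F := [seq x <- rs | 0 < x]; pose zer : seq F := [seq x <- rs | x == 0].
have perm_rs : perm_eq rs (pos ++ map -%R pos ++ zer).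
  apply: uniq_perm => // [|x].
    rewrite !cat_uniq (map_inj_uniq oppr_inj) !filter_uniq //= andbT.
    apply/andP; split; apply/hasPn => x.
      rewrite mem_cat => /orP[/mapP[y]|]; rewrite mem_filter => /andP[h _].
        by move=> ->; rewrite mem_filter oppr_gt0 ltNge (ltW h).
      by rewrite mem_filter (eqP h) ltxx.
    rewrite mem_filter => /andP[/eqP-> _].
    by apply/mapP => -[y]; rewrite mem_filter => /andP[h _] /eqP; rewrite eq_sym oppr_eq0 gt_eqF.
  have -> : (x \in pos ++ map -%R pos ++ zer) = [|| (0 < x) && (x \in rs), (x < 0) && (x \in rs) | (x == 0) && (x \in rs)].
    rewrite !mem_cat !mem_filter; congr (_ || (_ || _)).
    by rewrite -{1}(opprK x) mem_map ?mem_filter ?oppr_gt0 ?rs_opp //; exact: oppr_inj.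
  by case: (ltgtP x 0) => //=; rewrite ?orbF.
have zer_le : (size zer <= 1)%N.
  apply: (@uniq_leq_size _ zer [:: 0]); first exact: filter_uniq.
  by move=> x; rewrite mem_filter inE => /andP[].
have size_rs : n = (size zer + (size pos).*2)%N.
  have := perm_size perm_rs; rewrite size_mkseq !size_cat size_map -addnn => {1}->.
  by rewrite addnA addnC.
have zer_odd : size zer = odd n.
  rewrite size_rs oddD odd_double addbF.
  by move: zer_le; case: (size zer) => [|[|]].
have zerE : zer = nseq (odd n) 0.
  rewrite -zer_odd; apply/all_pred1P/allP => x; rewrite mem_filter => /andP[/eqP-> _] /=.
  by rewrite eqxx.
exists (sort <=%R (map (fun x => x ^+ 2) pos)); split.
- rewrite lt_sorted_uniq_le sort_uniq sort_le_sorted andbT map_inj_in_uniq ?filter_uniq //.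
  move=> x y; rewrite !mem_filter => /andP[x0 _] /andP[y0 _] /eqP.
  by rewrite eqrXn2 ?(ltW x0) ?(ltW y0) // => /eqP.
- move=> y; rewrite mem_sort => /mapP[x]; rewrite mem_filter => /andP[x0 /rs_in /andP[_ x1]] ->.
  by rewrite exprn_gt0 //= expr_lt1 // ltW.
- by rewrite size_sort size_map size_rs zer_odd halfD odd_double andbF doubleK; case: (odd n).
rewrite rs_G (perm_big _ perm_rs) /= !big_cat /= zerE.
rewrite (perm_big _ (permEl (perm_sort _ _))) /=.
rewrite !big_map mulrA -big_split /= mulrC; congr (_ * _).
  by case: (odd n); rewrite ?big_cons big_nil ?subr0 ?mulr1.
by apply: eq_bigr => x _; rewrite rmorphN rmorphXn /=; ring.
Qed.
End Zeros.

(** * Equilibrium of the zeros and monotonicity in the parameter *)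

Section Electrostatics.
Context (F : rcfType).

(* Vanishing logarithmic energy gradient at the zeros, in the variable [x ^+ 2]. *)
Lemma geg_zeros_equilibrium (lam : F) n (ys : seq F) (j : 'I_(size ys)) :
  0 <= lam -> sorted <%R ys -> (forall y, y \in ys -> 0 < y < 1) ->
  geg lam n = 'X^(odd n) * \prod_(y <- ys) ('X^2 - y%:P) ->
  (1 + 2 * (odd n)%:R) / ys`_j + 4 * \sum_(k < size ys | k != j) (ys`_j - ys`_k)^-1
    = (2 * lam + 1) / (1 - ys`_j).
Proof.
move=> lam0 ys_lt ys_in ys_G; set y := ys`_j.
have /andP[y0 y1] : 0 < y < 1 by apply: ys_in; rewrite mem_nth.
have y_neq (k : 'I_(size ys)) : k != j -> y - ys`_k != 0.
  by rewrite subr_eq0 nth_uniq ?(lt_sorted_uniq ys_lt) // eq_sym.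
pose x := Num.sqrt y.
have xx : x ^+ 2 = y by rewrite sqr_sqrtr // ltW.
have x0 : 0 < x by rewrite sqrtr_gt0.
have xN0 : x != 0 by rewrite gt_eqF.
pose H : {poly F} := 'X^(odd n) * \prod_(k < size ys | k != j) ('X^2 - (ys`_k)%:P).
have GH : geg lam n = ('X^2 - y%:P) * H.
  by rewrite ys_G (big_nth 0) big_mkord (bigD1 j) //= /H; ring.
(* [s] is the logarithmic derivative of [p] at [x]. It is additive over products, so that of [H] is
   a sum over the other zeros. *)
pose logder (p : {poly F}) (s : F) := p.[x] != 0 /\ p^`().[x] = p.[x] * s.
have logderM p q s t : logder p s -> logder q t -> logder (p * q) (s + t).
  move=> [p0 p1] [q0 q1]; split; first by rewrite hornerM mulf_neq0.
  rewrite derivM !hornerE p1 q1; ring.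
have [H0 H1] : logder H ((odd n)%:R / x + \sum_(k < size ys | k != j) (x *+ 2) / (y - ys`_k)).
  apply: (logderM).
    case: (odd n); rewrite /logder ?expr1 ?expr0 !derivE !hornerE ?mul0r ?oner_neq0 //.
    by split=> //; rewrite /= mulr1 divff.
  elim/big_rec2: _ => [|k s p kj h].
    by rewrite /logder !derivE !hornerE oner_neq0.
  apply: (logderM) h; rewrite /logder !derivE !hornerE xx.
  split; first exact: y_neq.
  by rewrite /= subr0 mulrAC divff ?y_neq // mul1r mulr2n.
have r : root (geg lam n) x by rewrite rootE GH hornerM !hornerE xx subrr /= ?mul0r.
have := geg_ode_root lam0 r; rewrite xx subr_eq0 eq_sym (lt_eqF y1) => /(_ isT).
clearbody H.
(* Since [x ^+ 2 = y], the first two derivatives at [x] involve only [H] and its derivative, and the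
   differential equation becomes a formula for the logarithmic derivative of [H]. *)
have -> : (geg lam n)^`().[x] = 2 * x * H.[x].
  rewrite GH !(derivE, hornerE) xx /=; ring.
have -> : (geg lam n)^`()^`().[x] = 2 * H.[x] + 4 * x * H^`().[x].
  rewrite GH !(derivE, hornerE) xx /=; ring.
rewrite H1.
have -> : \sum_(k < size ys | k != j) x *+ 2 / (y - ys`_k) =
          2 * x * \sum_(k < size ys | k != j) (y - ys`_k)^-1.
  by rewrite mulr_sumr; apply: eq_bigr => k _; rewrite mulr_natl.
set S := \sum_(_ < _ | _) _; set e := (odd n)%:R; set h := H.[x] in H0 *.
have -> : 2 * h + 4 * x * (h * (e / x + 2 * x * S)) =
          2 * h * (1 + 2 * e + 4 * x ^+ 2 * S) by field.
have -> : (2 * lam + 1) * x * (2 * x * h) = 2 * h * ((2 * lam + 1) * x ^+ 2) by ring.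
rewrite xx mulrCA => /(mulfI _) key.
have -> : (1 + 2 * e) / y + 4 * S = (1 + 2 * e + 4 * y * S) / y.
  by field; rewrite gt_eqF.
have yN0 : y != 0 by rewrite gt_eqF.
have y1N0 : 1 - y != 0 by rewrite subr_eq0 gt_eqF.
apply/eqP; rewrite eqr_div // mulrC key //.
by rewrite mulf_neq0 // pnatr_eq0.
Qed.

(** A larger parameter strengthens the repulsion from the endpoints and leaves the other forces in
    the equilibrium unchanged. *)
Lemma geg_zeros_antitone (lam mu : F) n (ys zs : seq F) :
  0 <= lam -> lam <= mu ->
  sorted <%R ys -> (forall y, y \in ys -> 0 < y < 1) ->
  geg lam n = 'X^(odd n) * \prod_(y <- ys) ('X^2 - y%:P) ->
  sorted <%R zs -> (forall y, y \in zs -> 0 < y < 1) ->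
  geg mu n = 'X^(odd n) * \prod_(y <- zs) ('X^2 - y%:P) ->
  size ys = size zs ->
  forall i, (i < size ys)%N -> zs`_i <= ys`_i.
Proof.
move=> lam0 lam_mu ys_lt ys_in ys_G zs_lt zs_in zs_G sz i0 i0lt.
rewrite leNgt; apply/negP => bad.
pose d (i : 'I_(size ys)) := zs`_i - ys`_i.
pose i1 : 'I_(size ys) := Ordinal i0lt.
case: (@arg_maxP _ _ _ i1 xpredT d isT) => j _ jmax.
have dj : 0 < d j by apply: lt_le_trans (jmax i1 isT); rewrite subr_gt0.
have Ey := geg_zeros_equilibrium j lam0 ys_lt ys_in ys_G.
have := @geg_zeros_equilibrium mu n zs (cast_ord sz j) (le_trans lam0 lam_mu) zs_lt zs_in zs_G.
rewrite /= => Ez.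
have /andP[y0 y1] : 0 < ys`_j < 1 by apply: ys_in; rewrite mem_nth.
have /andP[z0 z1] : 0 < zs`_j < 1 by apply: zs_in; rewrite mem_nth // -sz.
have lt1 : (1 + 2 * (odd n)%:R) / zs`_j < (1 + 2 * (odd n)%:R) / ys`_j.
  rewrite ltr_pM2l; last by rewrite ltr_pwDl ?mulr_ge0.
  by rewrite ltf_pV2 ?posrE // -subr_gt0.
have le2 : (2 * lam + 1) / (1 - ys`_j) <= (2 * mu + 1) / (1 - zs`_j).
  rewrite /d in dj; apply: ler_pM; rewrite ?invr_ge0 ?lef_pV2 ?posrE; clear -dj y1 z1 lam0 lam_mu; lra.
(* Maximality of [j] gives [y_j - y_k <= z_j - z_k]. Both lists are sorted, so the two differences
   have the same sign and reciprocals reverse the order. *)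
have le3 : \sum_(k < size zs | k != cast_ord sz j) (zs`_j - zs`_k)^-1 <= \sum_(k < size ys | k != j) (ys`_j - ys`_k)^-1.
  rewrite (reindex (cast_ord sz)) /=; last by exists (cast_ord (esym sz)) => k _; rewrite ?cast_ordK ?cast_ordKV.
  rewrite (eq_bigl (fun k => k != j)); last by move=> k; rewrite (inj_eq (@cast_ord_inj _ _ sz)).
  apply: ler_sum => k kj; have dk : zs`_k - ys`_k <= zs`_j - ys`_j := jmax k isT.
  have: (k < j)%N || (j < k)%N by rewrite -neq_ltn.
  case/orP => [lt_kj|lt_jk].
    have hy : ys`_k < ys`_j by rewrite (lt_sorted_ltn_nth 0 ys_lt) ?inE.
    have hz : zs`_k < zs`_j by rewrite (lt_sorted_ltn_nth 0 zs_lt) ?inE -?sz.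
    by rewrite lef_pV2 ?posrE; clear -dk hy hz; lra.
  have hy : ys`_j < ys`_k by rewrite (lt_sorted_ltn_nth 0 ys_lt) ?inE.
  have hz : zs`_j < zs`_k by rewrite (lt_sorted_ltn_nth 0 zs_lt) ?inE -?sz.
  by rewrite lef_nV2 ?negrE; clear -dk hy hz; lra.
have absurd (p q s t P Q : F) :
    p + 4 * s = P -> q + 4 * t = Q -> q < p -> P <= Q -> t <= s -> False by lra.
exact: absurd Ey Ez lt1 le2 le3.
Qed.
End Electrostatics.

(** * Moduli on the ellipse *)

Local Open Scope complex_scope.
Section Modulus.
Context (F : rcfType).

(** Squared modulus with values in the ordered field [F], so that comparing moduli becomes a
    polynomial inequality. *)
Definition sqn (z : F[i]) : F := complex.Re z ^+ 2 + complex.Im z ^+ 2.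
Definition gegC (lam : F) (n : nat) (z : F[i]) : F[i] :=
  (map_poly (real_complex F) (geg lam n)).[z].

Lemma sqnM z w : sqn (z * w) = sqn z * sqn w.
Proof. by case: z w => [a b] [c d]; rewrite /sqn /=; ring. Qed.
Lemma sqn_ge0 z : 0 <= sqn z.
Proof. by rewrite addr_ge0 ?sqr_ge0. Qed.
Lemma sqn1 : sqn 1 = 1.
Proof. by rewrite /sqn /=; ring. Qed.
Lemma sqnX z n : sqn (z ^+ n) = sqn z ^+ n.
Proof. by elim: n => [|n IH]; rewrite ?expr0 ?sqn1 // !exprS sqnM IH. Qed.
Lemma sqn_exp2_gt0 n : 0 < sqn (2 ^+ n).
Proof.
by rewrite sqnX exprn_gt0 // /sqn /= addr0 expr0n addr0 exprn_gt0 // addr_gt0.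
Qed.
Lemma sqn_prod (I : Type) (r : seq I) (f : I -> F[i]) :
  sqn (\prod_(i <- r) f i) = \prod_(i <- r) sqn (f i).
Proof. exact: (big_morph sqn sqnM sqn1). Qed.

Lemma gegC0 lam z : gegC lam 0 z = 1.
Proof. by rewrite /gegC geg0 rmorph1 hornerE. Qed.
Lemma gegC1 lam z : gegC lam 1 z = z.
Proof. by rewrite /gegC geg1 map_polyX hornerX. Qed.
Lemma gegCSS lam n z :
  gegC lam n.+2 z = z * gegC lam n.+1 z - (rec_coef lam n)%:C * gegC lam n z.
Proof. by rewrite /gegC gegSS rmorphB rmorphM /= map_polyX map_polyZ !hornerE. Qed.

Lemma sqn_gegC nu n ts w : geg nu n = 'X^(odd n) * \prod_(y <- ts) ('X^2 - y%:P) ->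
  sqn (gegC nu n w) = sqn w ^+ odd n * \prod_(k < size ts) sqn (w ^+ 2 - (ts`_k)%:C).
Proof.
move=> e; rewrite /gegC e rmorphM rmorph_prod /= map_polyXn hornerM hornerXn horner_prod.
rewrite sqnM sqnX sqn_prod (big_nth 0) big_mkord; congr (_ * _).
by apply: eq_bigr => k _; rewrite rmorphB /= map_polyXn map_polyC !hornerE.
Qed.

Section Ellipse.
Context (a b c s : F) (ab : a ^+ 2 = b ^+ 2 + 1) (cs : c ^+ 2 + s ^+ 2 = 1).
Context (b_ge : 1 / 2 <= b ^+ 2).
Let z : F[i] := (a * c) +i* (b * s).
Let zp : F[i] := 0 +i* b.

Lemma sqn_minor_sub (y : F) : sqn (zp ^+ 2 - y%:C) = (b ^+ 2 + y) ^+ 2.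
Proof. rewrite /sqn /= expr2 /=; ring. Qed.

(** The difference of the two sides is [c ^+ 2 * (y - y')] times a cofactor, which [b_ge] makes
    nonnegative. *)
Lemma sqn_factor_le (y y' : F) : 0 <= y' -> y' <= y -> y <= 1 ->
  sqn (z ^+ 2 - y%:C) * (b ^+ 2 + y') ^+ 2 <= sqn (z ^+ 2 - y'%:C) * (b ^+ 2 + y) ^+ 2.
Proof.
move=> y'0 y'y y1.
have E t : sqn (z ^+ 2 - t%:C) =
    (b ^+ 2 + t) ^+ 2 + c ^+ 2 * (c ^+ 2 - 1 + (2 * b ^+ 2 + 1) * (1 - 2 * t)).
  transitivity ((a ^+ 2 * c ^+ 2 - b ^+ 2 * s ^+ 2 - t) ^+ 2 +
      4 * a ^+ 2 * b ^+ 2 * c ^+ 2 * s ^+ 2); first by rewrite /sqn /= expr2 /=; ring.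
  have -> : s ^+ 2 = 1 - c ^+ 2 by rewrite -cs; ring.
  rewrite ab; ring.
rewrite !E; set B := b ^+ 2; set C := c ^+ 2.
have B_ge : 1 / 2 <= B := b_ge.
have C0 : 0 <= C by exact: sqr_ge0.
rewrite -subr_ge0.
have -> : forall A : F, ((B + y') ^+ 2 + C * (C - 1 + A * (1 - 2 * y'))) * (B + y) ^+ 2 -
   ((B + y) ^+ 2 + C * (C - 1 + A * (1 - 2 * y))) * (B + y') ^+ 2 =
   C * (y - y') * ((C - 1 + A) * (2 * B + y + y') + 2 * A * (B ^+ 2 - y * y')).
  by move=> A; ring.
apply: mulr_ge0; first by apply: mulr_ge0 => //; rewrite subr_ge0.
have y0 : 0 <= y := le_trans y'0 y'y.
have y'1 : y' <= 1 := le_trans y'y y1.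
have h1 : 0 <= C * (2 * B + y + y') by rewrite mulr_ge0 //; lra.
have h2 : 0 <= y * (1 - y') by rewrite mulr_ge0 //; lra.
have h3 : 0 <= y' * (1 - y) by rewrite mulr_ge0 //; lra.
have h4 : 0 <= B * (y * (1 - y') + y' * (1 - y)) by rewrite mulr_ge0 //; lra.
(* This is [4 (B - 1/2) (B + 1)^2], the cofactor at [C = 0], [y = y' = 1]: the source of the bound
   1/2. *)
have h5 : 0 <= (B - 1 / 2) * (B * 4 * B + 8 * B + 4).
  have B0 : 0 <= B by lra.
  have B2 : 0 <= B * B by apply: mulr_ge0.
  by apply: mulr_ge0; lra.
clear -h1 h2 h3 h4 h5 y1.
lra.
Qed.

(** Zeros are paired by rank and the products compared factor by factor; cross-multiplication avoids
    quotients. *)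
Lemma gegC_ratio_mono (lam mu : F) n : 0 <= lam -> lam <= mu ->
  sqn (gegC lam n z) * sqn (gegC mu n zp) <= sqn (gegC mu n z) * sqn (gegC lam n zp).
Proof.
move=> lam0 lam_mu.
have [ys [ys_lt ys_in ys_sz ys_G]] := geg_factor lam0 n.
have [zs [zs_lt zs_in zs_sz zs_G]] := geg_factor (le_trans lam0 lam_mu) n.
have sz : size ys = size zs by rewrite ys_sz.
have le_zy := geg_zeros_antitone lam0 lam_mu ys_lt ys_in ys_G zs_lt zs_in zs_G sz.
rewrite !(sqn_gegC _ ys_G) !(sqn_gegC _ zs_G) -!sz.
rewrite mulrACA [leRHS]mulrACA ler_wpM2l //.
  by rewrite mulr_ge0 ?exprn_ge0 ?sqn_ge0.
rewrite -!big_split /= ler_prod // => k _.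
have /andP[y0 y1] : 0 < ys`_k < 1 by apply: ys_in; rewrite mem_nth.
have /andP[z0 z1] : 0 < zs`_k < 1 by apply: zs_in; rewrite mem_nth // -sz.
rewrite !sqn_minor_sub mulr_ge0 ?sqn_ge0 ?sqr_ge0 //=.
by rewrite sqn_factor_le ?le_zy // ltW.
Qed.

Lemma gegC_minor_gt0 (lam : F) n : 0 <= lam -> 0 < sqn (gegC lam n zp).
Proof.
move=> lam0; have [ys [ys_lt ys_in ys_sz ys_G]] := geg_factor lam0 n.
have b2 : 0 < b ^+ 2 by apply: lt_le_trans b_ge; rewrite divr_gt0.
rewrite (sqn_gegC _ ys_G) mulr_gt0 //.
  by rewrite exprn_gt0 // /sqn /= expr0n /= add0r.
apply: prodr_gt0 => k _; rewrite sqn_minor_sub exprn_gt0 // ltr_wpDr // ltW //.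
by case/andP: (ys_in _ (mem_nth 0 (ltn_ord k))).
Qed.

End Ellipse.

(** * Closed forms of the Chebyshev cases *)

Section Joukowski.
Context (rho c s : F) (rho0 : 0 < rho) (cs : c ^+ 2 + s ^+ 2 = 1).
Let u : F[i] := (rho * c) +i* (rho * s).
Let w : F[i] := (rho^-1 * c) +i* (- (rho^-1 * s)).
Let z : F[i] := ((rho + rho^-1) / 2 * c) +i* ((rho - rho^-1) / 2 * s).
Let rhoN0 : rho != 0. Proof. by rewrite gt_eqF. Qed.

Lemma uw1 : u * w = 1.
Proof.
apply/eqP; rewrite eq_complex /=; apply/andP; split; apply/eqP; last by ring.
transitivity (rho / rho * (c ^+ 2 + s ^+ 2)); first by ring.
by rewrite cs divff // mulr1.
Qed.

Lemma uwz : u + w = 2 * z.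
Proof.
apply/eqP; rewrite eq_complex /=; apply/andP; split; apply/eqP; by field.
Qed.

(** The monic polynomial is [2^-n U_n]; both sides obey the recurrence with constant coefficient
    1/4. *)
Lemma gegC_lam1 n : 2 ^+ n * gegC 1 n z * (u - w) = u ^+ n.+1 - w ^+ n.+1.
Proof.
suff: 2 ^+ n * gegC 1 n z * (u - w) = u ^+ n.+1 - w ^+ n.+1 /\
  2 ^+ n.+1 * gegC 1 n.+1 z * (u - w) = u ^+ n.+2 - w ^+ n.+2 by case.
elim: n => [|n [h0 h1]].
  rewrite gegC0 gegC1 !expr0 !expr1 -uwz; split; ring.
split=> //; rewrite gegCSS.
have -> : rec_coef (1 : F) n = 1 / 4.
  case: n {h0 h1} => [|n] /=; first by field.
  by rewrite -(natr1 n.+1); field; rewrite nat1r !natr1 !pnatr_eq0.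
have e4 : (4 : F[i]) * ((1 / 4 : F)%:C) = 1.
  by apply/eqP; rewrite eq_complex /=; apply/andP; split; apply/eqP; field.
transitivity (2 * z * (2 ^+ n.+1 * gegC 1 n.+1 z * (u - w)) -
   4 * ((1 / 4 : F)%:C) * (2 ^+ n * gegC 1 n z * (u - w))).
  rewrite !exprS; ring.
rewrite e4 h0 h1 -uwz mul1r !exprS.
(* The recurrence for the powers holds up to a multiple of [u * w - 1], which is 0. *)
transitivity (u * (u * (u * u ^+ n)) - w * (w * (w * w ^+ n)) + (u * w - 1) * (u * u ^+ n - w * w ^+ n)).
  ring.
by rewrite uw1 subrr mul0r addr0.
Qed.

(** The Chebyshev [T] case starts at degree 1: at degree 0 the right side would be 2 instead of
    1. *)
Lemma gegC_lam0 n : 2 ^+ n.+1 * gegC 0 n.+1 z = u ^+ n.+1 + w ^+ n.+1.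
Proof.
suff: 2 ^+ n.+1 * gegC 0 n.+1 z = u ^+ n.+1 + w ^+ n.+1 /\
  2 ^+ n.+2 * gegC 0 n.+2 z = u ^+ n.+2 + w ^+ n.+2 by case.
elim: n => [|n [h0 h1]].
  rewrite gegCSS gegC1 gegC0 /= addr0 !mulr1.
  have e : (2 : F[i]) * ((2^-1 : F)%:C) = 1.
    by apply/eqP; rewrite eq_complex /=; apply/andP; split; apply/eqP; field.
  rewrite !expr1; split; first by rewrite uwz.
  transitivity ((2 * z) ^+ 2 - 2 * (2 * ((2^-1 : F)%:C))); first by ring.
  rewrite e -uwz; transitivity (u ^+ 2 + w ^+ 2 + 2 * (u * w - 1)); first by ring.
  by rewrite uw1 subrr mulr0 addr0.
split=> //; rewrite gegCSS.
have -> : rec_coef (0 : F) n.+1 = 1 / 4.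
  rewrite /= !addr0 mulr0 addr0.
  by rewrite -(natr1 n.+1); field; rewrite nat1r !natr1 !pnatr_eq0.
have e4 : (4 : F[i]) * ((1 / 4 : F)%:C) = 1.
  by apply/eqP; rewrite eq_complex /=; apply/andP; split; apply/eqP; field.
transitivity (2 * z * (2 ^+ n.+2 * gegC 0 n.+2 z) -
   4 * ((1 / 4 : F)%:C) * (2 ^+ n.+1 * gegC 0 n.+1 z)).
  rewrite !exprS; ring.
rewrite e4 h0 h1 -uwz mul1r !exprS.
transitivity (u * (u * (u * u ^+ n)) + w * (w * (w * w ^+ n)) + (u * w - 1) * (u * u ^+ n + w * w ^+ n)).
  ring.
by rewrite uw1 subrr mul0r addr0.
Qed.
End Joukowski.
End Modulus.

(** * Minimum property at the reference parameters, then in general *)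

Section Reference.
Context (F : rcfType) (rho : F) (rho0 : 0 < rho) (rho_ge : 4 <= rho ^+ 2 + rho^-1 ^+ 2).
(** Equal to [2 cosh (m log rho)]. *)
Let R m := rho ^+ m + rho^-1 ^+ m.
Let rhoN0 : rho != 0. Proof. by rewrite gt_eqF. Qed.
Let r := rho^-1.
Let rho_r : rho * r = 1. Proof. by rewrite divff. Qed.

(** With [c +i* s] of angle [theta], [cm] is [cos (m theta)]. The coordinates are [cos (m theta)]
    and [sin (m theta)] scaled by [rho^m] plus or minus [rho^-m], and these two powers have product
    1. *)
Lemma sqn_pow_sub_add (c s : F) m : c ^+ 2 + s ^+ 2 = 1 ->
  let u := (rho * c) +i* (rho * s) in
  let w := (rho^-1 * c) +i* (- (rho^-1 * s)) in
  let cm := complex.Re ((c +i* s) ^+ m) in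
  [/\ sqn (u ^+ m - w ^+ m) = R m ^+ 2 - 4 * cm ^+ 2,
      sqn (u ^+ m + w ^+ m) = R m ^+ 2 - 4 + 4 * cm ^+ 2 & cm ^+ 2 <= 1].
Proof.
move=> cs u w; set zeta := c +i* s.
have -> : u = rho%:C * zeta.
  by apply/eqP; rewrite eq_complex /=; apply/andP; split; apply/eqP; ring.
have -> : w = r%:C * zeta^*.
  by apply/eqP; rewrite eq_complex /= /r; apply/andP; split; apply/eqP; ring.
have : sqn (zeta ^+ m) = 1 by rewrite sqnX /sqn /= cs expr1n.
rewrite !exprMn -!rmorphXn /=.
have : rho ^+ m * r ^+ m = 1 by rewrite -exprMn rho_r expr1n.
rewrite /R -/r; move: (rho ^+ m) (r ^+ m) (zeta ^+ m) => p q [x y] /= pq.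
rewrite /sqn /= => xy.
have -> : x ^+ 2 = 1 - y ^+ 2 by rewrite -xy; ring.
have y0 := sqr_ge0 y; split; last by lra.
- transitivity ((p - q) ^+ 2 * x ^+ 2 + (p + q) ^+ 2 * y ^+ 2); first by ring.
  have -> : x ^+ 2 = 1 - y ^+ 2 by rewrite -xy; ring.
  have -> : (p - q) ^+ 2 = (p + q) ^+ 2 - 4 * (p * q) by ring.
  rewrite pq; ring.
transitivity ((p + q) ^+ 2 * x ^+ 2 + (p - q) ^+ 2 * y ^+ 2); first by ring.
have -> : x ^+ 2 = 1 - y ^+ 2 by rewrite -xy; ring.
have -> : (p - q) ^+ 2 = (p + q) ^+ 2 - 4 * (p * q) by ring.
rewrite pq; ring.
Qed.

(** Adding [2 theta] to the angle costs at most [|sin (2 theta)| <= 2 |cos theta|]. *)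
Lemma odd_cos_bound (c s : F) k : c ^+ 2 + s ^+ 2 = 1 ->
  `|complex.Re ((c +i* s) ^+ k.*2.+1)| <= k.*2.+1%:R * `|c|.
Proof.
move=> cs.
have le1 (x y : F) : x ^+ 2 + y ^+ 2 = 1 -> `|x| <= 1 /\ `|y| <= 1.
  move=> xy; have x0 := sqr_ge0 x; have y0 := sqr_ge0 y.
  by split; rewrite -(@ler_pXn2r _ 2) ?nnegrE // real_normK ?num_real // expr1n; lra.
elim: k => [|k IH]; first by rewrite expr1 mul1r.
have : sqn ((c +i* s) ^+ k.*2.+1) = 1 by rewrite sqnX /sqn /= cs expr1n.
rewrite doubleS (exprS _ k.*2.+2) (exprS _ k.*2.+1) mulrA.
move: IH; case: ((c +i* s) ^+ k.*2.+1) => [x y] /= IH; rewrite /sqn /= => /le1[hx hy].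
have -> : (c * c - s * s) * x - (c * s + s * c) * y = (c ^+ 2 - s ^+ 2) * x + c * (- 2 * s * y) by ring.
apply: (le_trans (ler_normD _ _)).
have c0 := sqr_ge0 c; have s0 := sqr_ge0 s.
have [hc hs] := le1 _ _ cs.
have e1 : `|(c ^+ 2 - s ^+ 2) * x| <= `|x|.
  by rewrite normrM ler_piMl // ler_norml; lra.
have e2 : `|c * (- 2 * s * y)| <= 2 * `|c|.
  have -> : `|c * (- 2 * s * y)| = 2 * `|c| * (`|s| * `|y|).
    rewrite !normrM normrN normr_nat; ring.
  by rewrite ler_piMr ?mulr_ile1 // mulr_ge0.
have -> : k.*2.+3%:R = k.*2.+1%:R + 2 :> F by rewrite -natrD addn2.
lra.
Qed.

(** Hyperbolic counterpart of [odd_cos_bound]. The induction also carries the gap between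
    consecutive odd indices, which [R 2 >= 4] keeps at least [2 * R 1]. *)
Lemma cosh_odd_bound k : k.*2.+1%:R * R 1 <= R k.*2.+1.
Proof.
have rec m : R m.+4 = R 2 * R m.+2 - R m.
  rewrite /R -/r !exprS.
  transitivity (rho * (rho * (rho * (rho * rho ^+ m))) + r * (r * (r * (r * r ^+ m))) +
    (rho * r + 1) * (rho * r - 1) * (rho ^+ m + r ^+ m)); last by ring.
  by rewrite rho_r subrr mulr0 mul0r addr0.
have R1 : 0 <= R 1 by rewrite /R addr_ge0 ?exprn_ge0 ?invr_ge0 ?ltW.
have R2 : 4 <= R 2 by [].
suff [] : k.*2.+1%:R * R 1 <= R k.*2.+1 /\ 2 * R 1 <= R k.*2.+3 - R k.*2.+1 by [].
elim: k => [|k [h0 h1]].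
  split; first by rewrite mul1r.
  have -> : R 3 = R 1 * (R 2 - 1).
    rewrite /R -/r !exprS !expr0.
    transitivity (rho * (rho * rho) + r * (r * r) + (rho * r - 1) * (rho + r)); last by ring.
    by rewrite rho_r subrr mul0r addr0 !mulr1.
  have : 0 <= R 1 * (R 2 - 4) by rewrite mulr_ge0 // subr_ge0.
  rewrite [0.*2]/=; lra.
rewrite doubleS.
have e : k.*2.+3%:R = k.*2.+1%:R + 2 :> F by rewrite -natrD addn2.
have pos : 0 <= R k.*2.+3 by rewrite /R addr_ge0 ?exprn_ge0 ?invr_ge0 ?ltW.
have : 0 <= (R 2 - 4) * R k.*2.+3 by rewrite mulr_ge0 // subr_ge0.
rewrite rec e; split; lra.
Qed.

Let a := (rho + rho^-1) / 2.
Let b := (rho - rho^-1) / 2.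

Lemma cosh1_sq_ge : 6 <= R 1 ^+ 2.
Proof.
have -> : R 1 ^+ 2 = rho ^+ 2 + rho^-1 ^+ 2 + 2 by rewrite /R !expr1; field.
by have := rho_ge; lra.
Qed.

Lemma minor_bound : a ^+ 2 = b ^+ 2 + 1 /\ 1 / 2 <= b ^+ 2.
Proof.
have e : b ^+ 2 = (rho ^+ 2 + rho^-1 ^+ 2 - 2) / 4.
  by rewrite /b; field.
by split; [rewrite /a /b; field | rewrite e ler_pdivlMr //; have := rho_ge; lra].
Qed.

(** The squared cosine of [m pi / 2], for the angle of the minor-axis endpoint. *)
Lemma Re_iX m : (complex.Re ((0 +i* 1 : F[i]) ^+ m)) ^+ 2 = (~~ odd m)%:R.
Proof.
rewrite -{1}(odd_double_half m) exprD -mul2n exprM.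
have -> : (0 +i* 1 : F[i]) ^+ 2 = -1 by exact: sqr_i.
have sg : (-1 : F[i]) ^+ m./2 = ((-1) ^+ m./2)%:C by rewrite rmorphXn rmorphN1.
rewrite sg; case: (odd m); rewrite ?expr1 ?expr0 /=.
  by rewrite mul0r mulr0 subrr expr0n.
by rewrite mul0r subr0 mul1r sqrr_sign.
Qed.

(** Up to a constant, the squared modulus is [R n.+1 ^+ 2 - 4 cos^2 ((n+1) theta)] over
    [R 1 ^+ 2 - 4 cos^2 theta]. The minor axis maximizes the denominator. *)
Lemma gegC_minor_sqn_lam1 n (c s : F) : c ^+ 2 + s ^+ 2 = 1 ->
  sqn (gegC 1 n (0 +i* b)) <= sqn (gegC 1 n ((a * c) +i* (b * s))).
Proof.
move=> cs.
have D_gt0 X : 6 <= X -> 0 < X - 4 * c ^+ 2 by have := sqr_ge0 s; lra.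
have cs' : (0 : F) ^+ 2 + 1 ^+ 2 = 1 by rewrite expr0n expr1n add0r.
have [d1 _ _] := sqn_pow_sub_add 1 cs; have [d1' _ _] := sqn_pow_sub_add 1 cs'.
have [dm _ cm1] := sqn_pow_sub_add n.+1 cs; have [dm' _ _] := sqn_pow_sub_add n.+1 cs'.
have := congr1 (@sqn F) (gegC_lam1 rho0 cs n); have := congr1 (@sqn F) (gegC_lam1 rho0 cs' n).
rewrite Re_iX [4 * _]mulr0 subr0 in d1'; rewrite Re_iX in dm'.
rewrite !expr1 in d1 d1'.
rewrite -/a -/b !sqnM dm dm' d1 d1' [a * 0]mulr0 [b * 1]mulr1 /=.
have K0 : 0 < sqn (2 ^+ n : F[i]) := sqn_exp2_gt0 F n.
have R1_ge := cosh1_sq_ge.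
have c0 := sqr_ge0 c.
set g := sqn (gegC 1 n ((a * c) +i* (b * s))).
set g' := sqn (gegC 1 n (0 +i* b)).
have g'0 : 0 <= g' := sqn_ge0 _.
move: K0 g'0; clearbody g g'; move: (sqn (2 ^+ n)) => K K0 g'0 E' E.
suff: K * g' * (R 1 ^+ 2 - 4 * c ^+ 2) <= K * g * (R 1 ^+ 2 - 4 * c ^+ 2).
  by rewrite ler_pM2r ?ler_pM2l // D_gt0.
rewrite E; move: E' cm1; set cm := complex.Re _.
(* For odd [n] the numerator is also smallest on the minor axis. *)
have [n_odd|n_even] := boolP (odd n) => /= E' cm1.
  have : 0 <= K * g' * c ^+ 2 by rewrite mulr_ge0 // mulr_ge0 // ltW.
  clear -E' cm1; lra.
(* For even [n] the numerator is largest there. Elsewhere it loses at most [4 (n+1)^2 c^2], which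
   the loss [4 c^2] of the denominator outweighs because [K * g'] is at least [(n+1)^2]. *)
have nE : n.+1 = n./2.*2.+1 by rewrite even_halfK.
have M0 : 0 <= n.+1%:R :> F by rewrite ler0n.
have hc : cm ^+ 2 <= n.+1%:R ^+ 2 * c ^+ 2.
  rewrite -[cm ^+ 2]real_normK ?num_real // -[c ^+ 2]real_normK ?num_real // -exprMn.
  rewrite ler_pXn2r ?nnegrE ?mulr_ge0 //.
  by rewrite /cm nE odd_cos_bound.
have hN : n.+1%:R ^+ 2 * R 1 ^+ 2 <= R n.+1 ^+ 2.
  have Rn m : 0 <= R m by rewrite /R addr_ge0 ?exprn_ge0 ?invr_ge0 ?ltW.
  rewrite -exprMn ler_pXn2r ?nnegrE ?mulr_ge0 //.
  by rewrite nE cosh_odd_bound.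
have le : n.+1%:R ^+ 2 <= K * g'.
  have D0 : 0 < R 1 ^+ 2 := lt_le_trans (ltr0Sn _ 5) R1_ge.
  by rewrite -(ler_pM2r D0) E' mulr0 subr0.
have : 0 <= (K * g' - n.+1%:R ^+ 2) * c ^+ 2 by rewrite mulr_ge0 // subr_ge0.
clear -E' hc; lra.
Qed.

(** Only [4 cos^2 (n theta)] varies along the ellipse, and for odd [n] it vanishes on the minor
    axis. *)
Lemma gegC_minor_sqn_lam0 n (c s : F) : c ^+ 2 + s ^+ 2 = 1 -> odd n ->
  sqn (gegC 0 n (0 +i* b)) <= sqn (gegC 0 n ((a * c) +i* (b * s))).
Proof.
move=> cs; case: n => // n n_odd.
have cs' : (0 : F) ^+ 2 + 1 ^+ 2 = 1 by rewrite expr0n expr1n add0r.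
have [_ dm _] := sqn_pow_sub_add n.+1 cs; have [_ dm' _] := sqn_pow_sub_add n.+1 cs'.
have := congr1 (@sqn F) (gegC_lam0 rho0 cs n); have := congr1 (@sqn F) (gegC_lam0 rho0 cs' n).
rewrite Re_iX n_odd [4 * _]mulr0 addr0 in dm'.
rewrite -/a -/b !sqnM dm dm' [a * 0]mulr0 [b * 1]mulr1 /= => E' E.
have K0 : 0 < sqn (2 ^+ n.+1 : F[i]) := sqn_exp2_gt0 F n.+1.
rewrite -(ler_pM2l K0) E E' lerDl mulr_ge0 ?sqr_ge0 //.
Qed.

Theorem gegC_minor_sqn (lam : F) n (c s : F) : c ^+ 2 + s ^+ 2 = 1 ->
  1 <= lam \/ 0 <= lam /\ odd n ->
  sqn (gegC lam n (0 +i* b)) <= sqn (gegC lam n ((a * c) +i* (b * s))).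
Proof.
move=> cs hlam; have [ab b_ge] := minor_bound.
have [mu [mu0 mu_lam mu_min]] : exists mu : F, [/\ 0 <= mu, mu <= lam &
    sqn (gegC mu n (0 +i* b)) <= sqn (gegC mu n ((a * c) +i* (b * s)))].
  case: hlam => [lam1|[lam0 n_odd]].
    by exists 1; split => //; exact: gegC_minor_sqn_lam1.
  by exists 0; split => //; exact: gegC_minor_sqn_lam0.
have ratio := gegC_ratio_mono ab cs b_ge n mu0 mu_lam.
have pos := gegC_minor_gt0 b_ge n mu0.
(* Multiplied by the minor-axis value at [mu], the goal passes through the ellipse value at [mu]
   times the minor-axis value at [lam]. *)
rewrite -(ler_pM2l pos) [leRHS]mulrC; apply: le_trans ratio.
by rewrite ler_wpM2r ?sqn_ge0.
Qed.
End Reference.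

(** * Transfer to the standard normalization and to pairs of reals *)

Definition toC (z : Defs.Cx) : Rdefinitions.R[i] := z.1 +i* z.2.

(** The leading coefficient [2^n (lam)_n / n!] of the standard polynomial, with [(lam)_n] the rising
    factorial. *)
Fixpoint lead_geg (lam : Rdefinitions.R) (n : nat) : Rdefinitions.R :=
  if n is m.+1 then lead_geg lam m * (2 * (m%:R + lam) / m.+1%:R) else 1.

Lemma lead_geg_rec_coef (lam : Rdefinitions.R) m : 0 < lam ->
  lead_geg lam m.+2 * rec_coef lam m = (m%:R + 2 * lam) / m.+2%:R * lead_geg lam m.
Proof.
move=> lam0 /=; move: (lead_geg lam m) => k.
have h1 := natDlam_neq0 (ltW lam0) m.
case: m h1 => [|m] h1 /=.
  by field; rewrite h1.
have h2 := natDlam_neq0 (ltW lam0) m.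
rewrite -(natr1 m.+2) -(natr1 m.+1) -(natr1 m) in h1 h2 *.
field.
by rewrite h1 h2 !natr1 !pnatr_eq0.
Qed.

Lemma toC_gegenbauer (lam : Rdefinitions.R) n z : 0 < lam ->
  toC (Defs.gegenbauer lam n z) = (lead_geg lam n)%:C * gegC lam n (toC z).
Proof.
move=> lam0; rewrite /Defs.gegenbauer.
suff: toC (Defs.gegen_pair lam n z).1 = (lead_geg lam n)%:C * gegC lam n (toC z) /\
      toC (Defs.gegen_pair lam n z).2 = (lead_geg lam n.+1)%:C * gegC lam n.+1 (toC z) by case.
elim: n => [|n [h0 h1]].
  rewrite gegC0 gegC1; split.
    by rewrite /toC /= mulr1.
  rewrite /toC /=; apply/eqP; rewrite eq_complex /= /Defs.Cre /Defs.Cim /=.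
  rewrite !RealsE /= ; apply/andP; split; apply/eqP; by field.
split=> //; rewrite gegCSS /=.
set p := Defs.gegen_pair lam n z in h0 h1 *.
transitivity ((2 * (n.+1%:R + lam) / n.+2%:R)%:C * (toC z * toC p.2) - ((n%:R + 2 * lam) / n.+2%:R)%:C * toC p.1).
  rewrite /toC; apply/eqP; rewrite eq_complex /= /Defs.Cre /Defs.Cim /=.
  rewrite !RealsE /=.
  have e2 : n.+2%:R = n%:R + 2 :> Rdefinitions.R by rewrite -addn2 natrD.
  by rewrite e2 -(natr1 n) !mul0r subr0 !addr0 subr0 !eqxx.
rewrite h0 h1 mulrBr [in RHS]mulrA [X in _ - X]mulrA [X in _ = _ - X]mulrA -!rmorphM.
rewrite -(lead_geg_rec_coef n lam0) /= !rmorphM; ring.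
Qed.

Lemma CabsE z : Defs.Cabs z = Num.sqrt (sqn (toC z)).
Proof. by rewrite /Defs.Cabs !RealsE. Qed.

Lemma ssrnat_odd n : odd n = PeanoNat.Nat.odd n.
Proof.
suff: odd n = PeanoNat.Nat.odd n /\ odd n.+1 = PeanoNat.Nat.odd n.+1 by case.
by elim: n => [|n [h0 h1]]; split=> //=; rewrite h0 negbK.
Qed.

Lemma gegenbauer_minor_le (lam rho c s : Rdefinitions.R) n :
  0 < rho -> 4 <= rho ^+ 2 + rho^-1 ^+ 2 -> c ^+ 2 + s ^+ 2 = 1 ->
  1 < lam \/ 0 < lam < 1 /\ odd n ->
  Defs.Cabs (Defs.gegenbauer lam n (0, (rho - rho^-1) / 2)) <=
  Defs.Cabs (Defs.gegenbauer lam n ((rho + rho^-1) / 2 * c, (rho - rho^-1) / 2 * s)).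
Proof.
move=> rho0 rho_ge cs hlam.
have [lam0 {}hlam] : 0 < lam /\ (1 <= lam \/ 0 <= lam /\ odd n).
  case: hlam => [lam1|[/andP[lam0 _] n_odd]].
    by split; [exact: lt_trans ltr01 lam1 | left; exact: ltW].
  by split=> //; right; rewrite n_odd ltW.
rewrite !CabsE !toC_gegenbauer // !sqnM ler_wsqrtr //.
apply: ler_wpM2l; first exact: sqn_ge0.
exact: gegC_minor_sqn.
Qed.

Local Close Scope complex_scope.
Local Close Scope ring_scope.
Import Rdefinitions Rfunctions.
Local Open Scope R_scope.
(** The assumptions on [rho] are invariant under inversion, so the statement applies to [/ rho]
    too. *)
Lemma Cabs_gegenbauer_minor (lam rho c s : R) (n : nat) :
  0 < rho -> 4 <= rho ^ 2 + (/ rho) ^ 2 -> c ^ 2 + s ^ 2 = 1 ->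
  1 < lam \/ (0 < lam < 1 /\ PeanoNat.Nat.odd n = true) ->
  Defs.Cabs (Defs.gegenbauer lam n (0, (rho - / rho) / 2)) <=
  Defs.Cabs (Defs.gegenbauer lam n ((rho + / rho) / 2 * c, (rho - / rho) / 2 * s)).
Proof.
rewrite !RealsE => /RltP rho0 /RleP rho_ge cs hlam.
apply/RleP/gegenbauer_minor_le => //.
case: hlam => [/RltP|[[/RltP lam0 /RltP lam1] n_odd]]; first by left.
by right; rewrite ssrnat_odd lam0.
Qed.

End GegenbauerZeros.

(* The threshold and the minimum over the ellipse *)
Require Import Defs.
From Stdlib Require Import Reals Lra.
Open Scope R_scope.

Lemma rho2_star_sq : rho2_star ^ 2 = 2 + sqrt 3.
Proof.
unfold rho2_star.
replace 6 with (2 * 3) by ring.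
rewrite sqrt_mult by lra.
pose proof (sqrt_sqrt 2 ltac:(lra)) as h2.
pose proof (sqrt_sqrt 3 ltac:(lra)) as h3.
replace (((sqrt 2 + sqrt 2 * sqrt 3) / 2) ^ 2)
  with ((sqrt 2 * sqrt 2) * (1 + 2 * sqrt 3 + sqrt 3 * sqrt 3) / 4) by field.
rewrite h2, h3; field.
Qed.

(** Divided by [rho + rho^-1], the equation [rho^3 + rho^-3 = 3 (rho + rho^-1)] becomes
    [rho^2 + rho^-2 = 4], whose root above 1 has square [2 + sqrt 3]. *)
Lemma rho2_star_le_bound (rho : R) :
  rho2_star <= rho -> 0 < rho /\ 4 <= rho ^ 2 + (/ rho) ^ 2.
Proof.
intros h.
assert (h0 : 0 < rho2_star).
{ unfold rho2_star; pose proof (sqrt_lt_R0 2 ltac:(lra)).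
  pose proof (sqrt_lt_R0 6 ltac:(lra)); lra. }
assert (hrho : 0 < rho) by lra.
split; [exact hrho|].
pose proof rho2_star_sq as hs.
pose proof (sqrt_sqrt 3 ltac:(lra)) as h3.
pose proof (sqrt_lt_R0 3 ltac:(lra)) as h3p.
assert (h1 : 2 + sqrt 3 <= rho ^ 2).
{ rewrite <- hs; apply pow_incr; lra. }
assert (hx : 0 < rho ^ 2) by nra.
replace ((/ rho) ^ 2) with (/ rho ^ 2) by (field; lra).
(* [2 + sqrt 3] and [2 - sqrt 3] are the roots of [x ^ 2 - 4 x + 1]. *)
assert (hq : 0 <= (rho ^ 2) * (rho ^ 2) - 4 * rho ^ 2 + 1) by nra.
apply Rmult_le_reg_l with (rho ^ 2); [exact hx|].
rewrite Rmult_plus_distr_l, Rinv_r by lra.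
lra.
Qed.

Lemma ellipse_point (rho theta : R) : 0 < rho ->
  Cscal (1 / 2) (Cadd (Cpolar rho theta) (Cinv (Cpolar rho theta))) =
  ((rho + / rho) / 2 * cos theta, (rho - / rho) / 2 * sin theta).
Proof.
intros hrho.
pose proof (sin2_cos2 theta) as h; unfold Rsqr in h.
assert (hd : (rho * cos theta) ^ 2 + (rho * sin theta) ^ 2 = rho ^ 2).
{ transitivity (rho ^ 2 * (sin theta * sin theta + cos theta * cos theta));
    [|rewrite h]; ring. }
unfold Cscal, Cadd, Cinv, Cpolar, Cre, Cim; cbn [fst snd].
rewrite hd.
f_equal; field; lra.
Qed.

Theorem mainTheorem7 (lam rho : R) (n : nat)
  (hrho : rho2_star <= rho) (hn : (2 <= n)%nat)
  (hlam : 1 < lam \/ (0 < lam < 1 /\ Nat.odd n = true)) :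
  let zp := (0, (rho - / rho) / 2) in
  let zm := (0, - ((rho - / rho) / 2)) in
  bernstein_ellipse rho zp /\ bernstein_ellipse rho zm /\
  Cabs (gegenbauer lam n zp) = Cabs (gegenbauer lam n zm) /\
  (forall z : Cx, bernstein_ellipse rho z ->
     Cabs (gegenbauer lam n zp) <= Cabs (gegenbauer lam n z)).
Proof.
destruct (rho2_star_le_bound rho hrho) as [rho0 rho_ge].
intros zp zm.
pose proof PI_RGT_0 as pi0.
split; [|split; [|split]].
- exists (PI / 2); split; [lra|].
  rewrite ellipse_point, cos_PI2, sin_PI2 by exact rho0.
  unfold zp; f_equal; ring.
- exists (3 * (PI / 2)); split; [lra|].
  rewrite ellipse_point, cos_3PI2, sin_3PI2 by exact rho0.
  unfold zm; f_equal; ring.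
(* With [c = 0], [s = -1] the general point of the ellipse is [zm], which gives one of the two
   inequalities. *)
- assert (unit_i : 0 ^ 2 + (-1) ^ 2 = 1) by ring.
  apply Rle_antisym.
  + pose proof (@GegenbauerZeros.Cabs_gegenbauer_minor lam rho 0 (-1) n
      rho0 rho_ge unit_i hlam) as h.
    replace ((rho + / rho) / 2 * 0, (rho - / rho) / 2 * -1) with zm in h
      by (unfold zm; f_equal; ring).
    exact h.
  + (* Replacing [rho] by [/ rho] exchanges [zp] and [zm]. *)
    assert (inv0 : 0 < / rho) by (apply Rinv_0_lt_compat; exact rho0).
    assert (inv_ge : 4 <= (/ rho) ^ 2 + (/ / rho) ^ 2)
      by (rewrite Rinv_inv; lra).
    pose proof (@GegenbauerZeros.Cabs_gegenbauer_minor lam (/ rho) 0 (-1) n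
      inv0 inv_ge unit_i hlam) as h.
    rewrite Rinv_inv in h.
    replace ((/ rho + rho) / 2 * 0, (/ rho - rho) / 2 * -1) with zp in h
      by (unfold zp; f_equal; unfold Rdiv; ring).
    replace (0, (/ rho - rho) / 2) with zm in h
      by (unfold zm; f_equal; unfold Rdiv; ring).
    exact h.
- intros z [theta [_ ->]].
  rewrite ellipse_point by exact rho0.
  apply GegenbauerZeros.Cabs_gegenbauer_minor; try assumption.
  pose proof (sin2_cos2 theta) as h; unfold Rsqr in h.
  rewrite <- h; ring.
Qed.
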